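(* Let $\Lambda$ be a group, $\Gamma<\Lambda$ an amenable subgroup, $C\ge1$, $0<\varepsilon<(10C)^{-1}$, $\mathcal H$ a Hilbert space, and $\pi:\Lambda\to B(\mathcal H)$ a map such that $\pi(e)=\mathrm{Id}$ and, for every $x\in\Gamma$ and $h\in\Lambda$, $\pi(x)\in U(\mathcal H)$, $\|\pi(h)\|\le C$ and $\|\pi(xh)-\pi(x)\pi(h)\|\le\varepsilon$. Then there is a map $\sigma:\Lambda\to B(\mathcal H)$ such that for every $x\in\Gamma$ and $h\in\Lambda$: $\|\sigma(h)-\pi(h)\|\le\varepsilon+120C\varepsilon^2$, $\sigma(x)\in U(\mathcal H)$, $\|\sigma(h)\|\le C$, and $\sigma(xh)=\sigma(x)\sigma(h)$.
   Context: $B(\mathcal H)$ denotes the bounded operators on $\mathcal H$ with operator norm $\|\cdot\|$, and $U(\mathcal H)$ the unitary group. *)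

(* Defs.v *)
(* MathComp 2.5 (monoid.v groupType) + MathComp-Analysis
   (realType, classical sets, sup) + real_closed (complex numbers R[i]). *)
From HB Require Import structures.
From mathcomp Require Import all_boot all_order all_algebra.
From mathcomp Require Import boolp classical_sets reals.
From mathcomp Require Import complex.

Set Implicit Arguments.
Unset Strict Implicit.
Unset Printing Implicit Defensive.

Import Order.TTheory GRing.Theory Num.Theory.
Local Open Scope ring_scope.
Local Open Scope classical_set_scope.

(* Complex Hilbert spaces: a left module over C = R[i] with an inner   *)
(* product (linear in the first variable, conjugate symmetric,         *)
(* positive definite) whose induced norm is complete.                  *)

Section Hilbert.
Variables (R : realType) (H : lmodType R[i]) (ip : H -> H -> R[i]).

(* the norm induced by the inner product *)
Definition hnorm (x : H) : R := Num.sqrt (complex.Re (ip x x)).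

Definition hs_hilbert : Prop :=
  [/\ (forall (a : R[i]) (x y z : H), ip (a *: x + y) z = a * ip x z + ip y z),
      (forall x y : H, ip y x = (ip x y)^*),
      (forall x : H, 0 <= ip x x),
      (forall x : H, ip x x = 0 -> x = 0) &
      (* completeness: every Cauchy sequence converges *)
      (forall u : nat -> H,
         (forall e : R, 0 < e -> exists N : nat, forall m n : nat,
              (N <= m)%N -> (N <= n)%N -> hnorm (u m - u n) < e) ->
         exists l : H, forall e : R, 0 < e -> exists N : nat, forall n : nat,
              (N <= n)%N -> hnorm (u n - l) < e)].

(* B(H): bounded linear operators *)
Definition hs_bounded_op (T : H -> H) : Prop :=
  (forall (a : R[i]) (x y : H), T (a *: x + y) = a *: T x + T y) /\
  exists c : R, forall x : H, hnorm (T x) <= c * hnorm x.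

(* operator norm ||T|| = sup { ||T x|| : ||x|| <= 1 } *)
Definition hs_opnorm (T : H -> H) : R :=
  sup [set hnorm (T x) | x in [set x : H | hnorm x <= 1]].

(* U(H): unitary operators, i.e. bounded operators U with U^* U = U U^* = Id *)
Definition hs_unitary (U : H -> H) : Prop :=
  hs_bounded_op U /\
  exists V : H -> H,
    (forall x y : H, ip (U x) y = ip x (V y)) /\ cancel U V /\ cancel V U.

End Hilbert.

(* Amenability of a subgroup Gam of a group L (von Neumann): there is  *)
(* a finitely additive, left-invariant probability measure defined on  *)
(* all subsets of Gam.                                                  *)

Section Amenable.
Local Open Scope group_scope.
Variables (R : realType) (L : groupType).

Definition amenable_subgroup (Gam : {pred L}) : Prop :=
  exists m : set L -> R,
    [/\ (forall A : set L, A `<=` [set x | x \in Gam] -> (0 <= m A)%R),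
        m [set x | x \in Gam] = 1%R,
        (forall A B : set L, A `<=` [set x | x \in Gam] ->
            B `<=` [set x | x \in Gam] -> A `&` B = set0 ->
            m (A `|` B) = (m A + m B)%R) &
        (forall (g : L) (A : set L), g \in Gam -> A `<=` [set x | x \in Gam] ->
            m [set g * a | a in A] = m A)].

End Amenable.

(* Main.v *)
(* One averaging step over [Gam] squares the defect. For a right-invariant mean
   on [Gam] put [p'(h) = mean_x p(x)^* p(xh)]. Then [|p' - p| <= e], the defect
   of [p'] is at most [2 e^2], and [p'(x)^* = p'(x^-1)] on [Gam], so there [p']
   is within [2 e^2] of being unitary; replacing it on [Gam] by the unitary part
   of its polar decomposition gives a new almost representation with defect at
   most [8 C e^2 <= 4/5 e]. Only the first step moves [p] by order [e]; the
   later ones sum to [O(C e^2)], and the limit is the required [sigma].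
   Throughout, the Hilbert space is handled through the real inner product
   [Re (ip x y)], against which vector identities are tested. *)
Require Import Defs.
From HB Require Import structures.
From mathcomp Require Import all_boot all_order all_algebra.
From mathcomp Require Import boolp classical_sets reals.
From mathcomp Require Import complex ring lra.
Import Order.TTheory GRing.Theory Num.Theory.
Local Open Scope ring_scope.

(** Amenability supplies only a finitely additive set function, so bounded real functions are
    integrated through finite partitions, and vectors are averaged weakly: the mean of [f] is the
    vector representing [w |-> I (rip (f x) w)]. A real mean suffices because [rip] separates
    vectors; complex homogeneity returns by moving a scalar across [rip] as its conjugate. A mean of
    unitaries is in general only a contraction, while the next averaging step needs [p(x)^*] to be
    the inverse of [p(x)]. This forces the correction on [Gam], whose cost must again be of order
    [e^2], or the gain from averaging would be lost. The inverses are carried as data [q] and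
    corrected together with [p], and all limits come with a geometric rate, so that each identity
    passes to the limit by an explicit error bound. *)

(** * Integration against a finitely additive probability carried by [G] *)

Section FinitelyAdditiveMean.
Local Open Scope classical_set_scope.
Variables (R : realType) (T : Type) (G : set T) (mu : set T -> R).
Hypothesis mu_ge0 : forall A, 0 <= mu A.
Hypothesis mu_T : mu setT = 1.
Hypothesis muU : forall A B, A `&` B = set0 -> mu (A `|` B) = mu A + mu B.
Hypothesis mu_out : forall A, A `&` G = set0 -> mu A = 0.

Lemma mu_set0 : mu set0 = 0.
Proof. by rewrite mu_out // set0I. Qed.

Lemma mu_fibers (I : finType) (p : T -> I) (A : set T) :
  \sum_i mu (A `&` [set x | p x = i]) = mu A.
Proof.
have aux (s : seq I) : uniq s ->
    \sum_(i <- s) mu (A `&` [set x | p x = i]) =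
    mu (A `&` [set x | p x \in s]).
  elim: s => [_|i s IHs /= /andP[is_ us]].
    rewrite big_nil (_ : A `&` _ = set0) ?mu_set0 //.
    by apply/seteqP; split=> x // [].
  rewrite big_cons IHs // -muU.
    congr mu; apply/seteqP; split=> x /=.
      by case=> -[Ax h]; rewrite inE h ?eqxx ?orbT.
    by case=> Ax; rewrite inE => /orP[/eqP|]; [left|right].
  by apply/seteqP; split=> x //= [[_ pxi]] [_]; rewrite pxi (negbTE is_).
rewrite -[RHS](_ : mu (A `&` [set x | p x \in index_enum I]) = _).
  by rewrite -aux // index_enum_uniq.
by congr mu; apply/seteqP; split=> x /= => [[]|Ax] //; rewrite mem_index_enum.
Qed.

Definition simple_int {I : finType} (p : T -> I) (c : I -> R) : R :=
  \sum_i c i * mu [set x | p x = i].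

Lemma simple_int_pair (I J : finType) (p : T -> I) (q : T -> J) (c : I -> R) :
  simple_int p c =
  \sum_i \sum_j c i * mu [set x | p x = i /\ q x = j].
Proof.
apply: eq_bigr => i _; rewrite -mulr_sumr; congr (_ * _).
by rewrite -(mu_fibers J q).
Qed.

(** Both integrals are written over the common refinement of the two partitions: a cell either meets
    [G], where [cd] compares the coefficients, or is null by [mu_out]. The slack contributes [e]
    because the total mass is 1. *)
Lemma simple_int_le (I J : finType) (p : T -> I) (q : T -> J)
    (c : I -> R) (d : J -> R) (e : R) :
  (forall x, G x -> c (p x) <= d (q x) + e) ->
  simple_int p c <= simple_int q d + e.
Proof.
move=> cd.
have -> : e = \sum_i \sum_j e * mu [set x | p x = i /\ q x = j].
  rewrite -[LHS](mulr1 e) -mu_T -(mu_fibers I p setT) mulr_sumr.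
  apply: eq_bigr => i _; rewrite -mulr_sumr; congr (_ * _).
  by rewrite setTI -(mu_fibers J q).
have -> : simple_int q d =
    \sum_i \sum_j d j * mu [set x | p x = i /\ q x = j].
  rewrite (simple_int_pair J I q p) exchange_big /=; apply: eq_bigr => i _.
  apply: eq_bigr => j _; congr (_ * mu _).
  by apply/seteqP; split=> x /= [].
rewrite (simple_int_pair I J p q) -big_split; apply: ler_sum => i _ /=.
rewrite -big_split; apply: ler_sum => j _ /=; rewrite -mulrDl.
have [[x [Gx [pxi qxj]]]|Nx] :=
  pselect (exists x, G x /\ (p x = i /\ q x = j)).
  by apply: ler_wpM2r => //; rewrite -pxi -qxj; apply: cd.
rewrite mu_out ?mulr0 //; apply/seteqP; split=> x //= [pq Gx].
by apply: Nx; exists x.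
Qed.

Lemma simple_intD (I J : finType) (p : T -> I) (q : T -> J)
    (c : I -> R) (d : J -> R) :
  simple_int p c + simple_int q d =
  simple_int (fun x => (p x, q x)) (fun k => c k.1 + d k.2).
Proof.
rewrite (simple_int_pair I J p q) (simple_int_pair J I q p) [in X in _ + X]exchange_big /=.
rewrite -big_split /simple_int.
rewrite [RHS](_ : _ = \sum_i \sum_j (c i + d j) * mu [set x | (p x, q x) = (i, j)]).
apply: eq_bigr => i _; rewrite -big_split /=; apply: eq_bigr => j _.
rewrite mulrDl; congr (_ * mu _ + _ * mu _); apply/seteqP; split=> x /=.
- by case=> -> ->.
- by case=> -> ->.
- by case=> -> ->.
- by case=> -> ->.
by rewrite pair_bigA; apply: eq_bigr => -[].
Qed.

Lemma simple_intZ (I : finType) (p : T -> I) (c : I -> R) (r : R) :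
  simple_int p (fun i => r * c i) = r * simple_int p c.
Proof. by rewrite mulr_sumr; apply: eq_bigr => i _; rewrite mulrA. Qed.

Lemma simple_int_cst (c : R) : simple_int (fun=> tt) (fun=> c) = c.
Proof.
rewrite /simple_int -mulr_sumr -[RHS]mulr1 -mu_T; congr (_ * _).
rewrite -(mu_fibers unit (fun=> tt)); apply: eq_bigr => i _.
by congr mu; rewrite setTI.
Qed.

Definition bounded_on (f : T -> R) := exists K : R, forall x, G x -> `|f x| <= K.

Lemma simple_approx (f : T -> R) (e : R) : bounded_on f -> 0 < e ->
  exists (I : finType) (p : T -> I) (c : I -> R),
    forall x, G x -> c (p x) <= f x /\ f x <= c (p x) + e.
Proof.
move=> [K fK] e0.
(* The range [[-K, K]] is cut into slices of width [e]; [N] is the last index that [(f x + K) / e]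
   can reach. *)
pose N := Num.trunc (2 * K / e).
exists 'I_N.+1, (fun x => inord (Num.trunc ((f x + K) / e))),
  (fun i : 'I_N.+1 => i%:R * e - K) => x Gx.
have /andP[fl fu] : - K <= f x <= K by rewrite -ler_norml fK.
have q0 : 0 <= (f x + K) / e by apply: divr_ge0; lra.
rewrite inordK; last first.
  rewrite ltnS; apply: le_truncn; apply: ler_pM => //; [lra|by rewrite invr_ge0 ltW|lra].
have /andP[] := truncn_itv q0; move: (Num.trunc _) => n.
rewrite ler_pdivlMr // ltr_pdivrMr // -addn1 natrD mulrDl mul1r => h1 h2.
by split; lra.
Qed.

(** The lower integral. It is controlled only when simple functions approximate [f] on [G] from both
    sides, hence the [bounded_on] hypotheses below. *)
Definition mean (f : T -> R) : R :=
  sup [set s | exists (I : finType) (p : T -> I) (c : I -> R),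
    (forall x, G x -> c (p x) <= f x) /\ s = simple_int p c].

Lemma mean_approx (f : T -> R) (I : finType) (p : T -> I) (c : I -> R) (e : R) :
  (forall x, G x -> c (p x) <= f x /\ f x <= c (p x) + e) ->
  simple_int p c <= mean f <= simple_int p c + e.
Proof.
move=> cf.
have ub : ubound [set s | exists (I : finType) (p : T -> I) (c : I -> R),
    (forall x, G x -> c (p x) <= f x) /\ s = simple_int p c] (simple_int p c + e).
  move=> _ [J [q [d [df ->]]]]; apply: simple_int_le => x Gx.
  by apply: le_trans (df _ Gx) _; case: (cf x Gx).
have mem : [set s | exists (I : finType) (p : T -> I) (c : I -> R),
    (forall x, G x -> c (p x) <= f x) /\ s = simple_int p c] (simple_int p c).
  by exists I, p, c; split=> // x /cf[].
apply/andP; split.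
  by apply: ub_le_sup mem; exists (simple_int p c + e).
by apply: ge_sup => //; exists (simple_int p c).
Qed.

Lemma eq_of_approx (a b K : R) :
  (forall e, 0 < e -> `|a - b| <= K * e) -> a = b.
Proof.
move=> ab; apply/eqP; rewrite -subr_eq0 -normr_le0 leNgt; apply/negP => d0.
have K0 : 0 < `|K| + 1 by rewrite ltr_wpDl.
have e0 : 0 < `|a - b| / (2 * (`|K| + 1)) by rewrite divr_gt0 // mulr_gt0.
have h2 : K * (`|a - b| / (2 * (`|K| + 1))) <= `|a - b| / 2.
  rewrite [X in _ <= X](_ : _ = (`|K| + 1) * (`|a - b| / (2 * (`|K| + 1)))).
    apply: ler_wpM2r; first exact: ltW.
    by have := ler_norm K; lra.
  by field; rewrite gt_eqF.
by have := ab _ e0; lra.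
Qed.

Lemma meanD (f g : T -> R) : bounded_on f -> bounded_on g ->
  mean (fun x => f x + g x) = mean f + mean g.
Proof.
move=> bf bg; apply: (@eq_of_approx _ _ 4) => e e0.
have [I [p [c cf]]] := simple_approx f e bf e0.
have [J [q [d dg]]] := simple_approx g e bg e0.
have /andP[f1 f2] := mean_approx f I p c e cf.
have /andP[g1 g2] := mean_approx g J q d e dg.
have /andP[h1 h2] := mean_approx (fun x => f x + g x) _
  (fun x => (p x, q x)) (fun k => c k.1 + d k.2) (2 * e)
  ltac:(move=> x Gx /=; have [] := cf x Gx; have [] := dg x Gx; lra).
by rewrite -simple_intD in h1 h2; rewrite ler_norml; lra.
Qed.

Lemma mean_cst (c : R) : mean (fun=> c) = c.
Proof.
have /andP[] := mean_approx (fun=> c) unit (fun=> tt) (fun=> c) 0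
  ltac:(by move=> x _; rewrite addr0).
by rewrite simple_int_cst addr0 => h1 h2; apply/eqP; rewrite eq_le h1 h2.
Qed.

Lemma mean_le (f g : T -> R) : bounded_on f -> bounded_on g ->
  (forall x, G x -> f x <= g x) -> mean f <= mean g.
Proof.
move=> bf bg fg; apply/ler_addgt0Pr => e e0.
have [I [p [c cf]]] := simple_approx f (e / 2) bf ltac:(lra).
have [J [q [d dg]]] := simple_approx g (e / 2) bg ltac:(lra).
have /andP[f1 f2] := mean_approx f I p c _ cf.
have /andP[g1 g2] := mean_approx g J q d _ dg.
have := simple_int_le I J p q c d (e / 2)
  ltac:(move=> x Gx; have := fg x Gx; have [] := cf x Gx; have [] := dg x Gx; lra).
lra.
Qed.

Lemma eq_mean (f g : T -> R) :
  (forall x, G x -> f x = g x) -> mean f = mean g.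
Proof.
move=> fg; congr sup; apply/seteqP.
split=> _ [I [p [c [cf ->]]]]; exists I, p, c; split=> // x Gx.
  by rewrite -fg //; apply: cf.
by rewrite fg //; apply: cf.
Qed.

Lemma meanZ (f : T -> R) (r : R) : bounded_on f ->
  mean (fun x => r * f x) = r * mean f.
Proof.
have pos (s : R) : 0 <= s -> bounded_on f -> mean (fun x => s * f x) = s * mean f.
  move=> s0 bf; apply: (@eq_of_approx _ _ (2 * s)) => e e0.
  have [I [p [c cf]]] := simple_approx f e bf e0.
  have /andP[f1 f2] := mean_approx f I p c e cf.
  have /andP[] := mean_approx (fun x => s * f x) _ p (fun i => s * c i) (s * e)
    ltac:(move=> x Gx; rewrite -mulrDr; have [h1 h2] := cf x Gx;
          by split; apply: ler_wpM2l).
  rewrite simple_intZ -mulrDr => h1 h2; rewrite ler_norml.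
  have := ler_wpM2l s0 f1; have := ler_wpM2l s0 f2; rewrite !mulrDr => *.
  by have := mulr_ge0 s0 (ltW e0); lra.
move=> bf; have [r0|r0] := leP 0 r; first exact: pos.
have r1 : 0 <= - r by lra.
have [K fK] := bf.
have bz (s : R) : bounded_on (fun x => s * f x).
  exists (`|s| * K) => x Gx; rewrite normrM.
  by apply: ler_wpM2l => //; apply: fK.
(* A negative factor turns lower sums into upper sums; additivity applied to [r f + (- r) f = 0]
   reduces to the positive case. *)
have := meanD _ _ (bz r) (bz (- r)).
rewrite (eq_mean _ (fun=> 0)); last by move=> x _; rewrite -mulrDl subrr mul0r.
by rewrite mean_cst (pos _ r1 bf); lra.
Qed.

Lemma mean_norm_le (f : T -> R) (K : R) :
  (forall x, G x -> `|f x| <= K) -> `|mean f| <= K.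
Proof.
move=> fK; have bf : bounded_on f by exists K.
have bc (c : R) : bounded_on (fun=> c) by exists `|c|.
rewrite ler_norml -{1}(mean_cst (- K)) -{2}(mean_cst K).
by apply/andP; split; apply: mean_le => // x Gx; have := fK x Gx; rewrite ler_norml; lra.
Qed.

Lemma mean_reindex (t : T -> T) (f : T -> R) :
  (forall x, G x -> G (t x)) -> (forall A, mu [set x | A (t x)] = mu A) ->
  bounded_on f -> mean (fun x => f (t x)) = mean f.
Proof.
move=> tG tmu bf; apply: (@eq_of_approx _ _ 1) => e e0.
have [I [p [c cf]]] := simple_approx f e bf e0.
have /andP[f1 f2] := mean_approx f I p c e cf.
have /andP[] := mean_approx (fun x => f (t x)) I (fun x => p (t x)) c e
  ltac:(by move=> x /tG; apply: cf).
rewrite (_ : simple_int (fun x => p (t x)) c = simple_int p c).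
  by move=> h1 h2; rewrite ler_norml; lra.
by apply: eq_bigr => i _; rewrite -[in RHS]tmu.
Qed.

End FinitelyAdditiveMean.

(** * A right-invariant mean on an amenable subgroup *)

Lemma amenable_right_mean (R : realType) (L : groupType) (Gam : {pred L}) :
  group_closed Gam -> amenable_subgroup R Gam ->
  exists I : (L -> R) -> R,
  let bnd := bounded_on R L [set` Gam]%classic in
  [/\ (forall f g, bnd f -> bnd g -> I (fun x => f x + g x) = I f + I g),
      (forall f r, bnd f -> I (fun x => r * f x) = r * I f),
      (forall f K, {in Gam, forall x, `|f x| <= K} -> `|I f| <= K),
      (forall c, I (fun=> c) = c) &
      (forall f g, g \in Gam -> bnd f -> I (fun x => f (x * g)%g) = I f) /\
      (forall f g, {in Gam, f =1 g} -> I f = I g)].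
Proof.
move=> gG [m [m0 m1 mU mI]].
have [G1 _] := gG; have GV := group_closedV gG; have GM := group_closedM gG.
(* Inversion turns left-invariance of [m] into right-invariance of [mu]; cutting down to [Gam] makes
   [mu] defined on all subsets of [L]. *)
pose inv_in (A : set L) := [set x | x \in Gam /\ A x^-1%g]%classic.
have inv_sub A : (inv_in A `<=` [set x | x \in Gam])%classic by move=> x [].
pose mu A := m (inv_in A).
have mu_out A : (A `&` [set` Gam] = set0)%classic -> mu A = 0.
  move=> A0.
  have e0 : (inv_in A = set0)%classic.
    apply/seteqP; split=> x // -[xG Ax].
    suff: (set0 : set L)%classic x^-1%g by [].
    by rewrite -A0; split=> //; apply: GV.
  have := mU set0 set0 ltac:(by []) ltac:(by []) (setI0 _).
  by rewrite setU0 /mu e0; lra.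
have mu0 A : 0 <= mu A by apply: m0.
have mu1 : mu setT = 1.
  by rewrite -m1; congr m; apply/seteqP; split=> x //= [].
have muU A B : (A `&` B = set0)%classic -> mu (A `|` B)%classic = mu A + mu B.
  move=> AB; rewrite -mU //; last first.
    apply/seteqP; split=> x // [[_ Ax] [_ Bx]].
    suff: (set0 : set L)%classic x^-1%g by [].
    by rewrite -AB.
  by congr m; apply/seteqP; split=> x /= [];
    [move=> xG []|move=> []|move=> []]; rewrite /inv_in /=; tauto.
exists (mean R L [set` Gam]%classic mu); split.
- by move=> f g; apply: meanD.
- by move=> f r; apply: meanZ.
- by move=> f K fK; apply: mean_norm_le.
- by move=> c; apply: mean_cst.
split=> [f g gGam bf|f g fg]; last exact: eq_mean.
apply: (mean_reindex R L [set` Gam]%classic mu mu0 mu1 muU mu_out (fun x => (x * g)%g)) => //.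
  by move=> x /= xG; apply: GM.
(* Inverting [{x | A (x * g)}] yields the left translate of [inv_in A] by [g]: for [y = g^-1 * x]
   one has [y^-1 = x^-1 * g]. *)
move=> A; rewrite /mu -(mI g (inv_in A)) //; congr m.
apply/seteqP; split=> x /=.
  case=> xG Ax; exists (g^-1 * x)%g; last by rewrite mulgA mulgV mul1g.
  by split; [apply: GM => //; apply: GV|rewrite invgM invgK].
case=> y [yG Ay] <-; split; first exact: GM.
by rewrite invgM /= -mulgA mulVg mulg1.
Qed.

(** * The real inner product and Riesz representation *)

Section HilbertSpace.
Variables (R : realType) (H : lmodType R[i]) (ip : H -> H -> R[i]).
Hypothesis hH : hs_hilbert ip.

Definition rip (x y : H) : R := complex.Re (ip x y).
Local Notation nm := (hnorm ip).

Lemma ipDl x y z : ip (x + y) z = ip x z + ip y z.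
Proof. by have [lin _ _ _ _] := hH; rewrite -[x]scale1r lin mul1r scale1r. Qed.

Lemma ip0l z : ip 0 z = 0.
Proof. by apply: (addrI (ip 0 z)); rewrite -ipDl !addr0. Qed.

Lemma ipZl a x z : ip (a *: x) z = a * ip x z.
Proof. by have [lin _ _ _ _] := hH; rewrite -[a *: x]addr0 lin ip0l addr0. Qed.

Lemma ipZr a x z : ip x (a *: z) = a^* * ip x z.
Proof.
by have [_ sym _ _ _] := hH; rewrite sym ipZl rmorphM /= -sym.
Qed.

Lemma ripC x y : rip x y = rip y x.
Proof. by have [_ sym _ _ _] := hH; rewrite /rip sym; case: (ip y x). Qed.

Lemma ripDl x y z : rip (x + y) z = rip x z + rip y z.
Proof. by rewrite /rip ipDl; case: (ip x z) (ip y z) => [a b] [c d]. Qed.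

Lemma ripZl (r : R) x z : rip (r%:C%C *: x) z = r * rip x z.
Proof. by rewrite /rip ipZl; case: (ip x z) => a b /=; rewrite mul0r subr0. Qed.

Lemma ripNl x z : rip (- x) z = - rip x z.
Proof. by apply/eqP; rewrite -addr_eq0 -ripDl addNr /rip ip0l. Qed.

Lemma ripDr x y z : rip x (y + z) = rip x y + rip x z.
Proof. by rewrite ![rip x _]ripC ripDl. Qed.

Lemma ripZr (r : R) x z : rip x (r%:C%C *: z) = r * rip x z.
Proof. by rewrite ![rip x _]ripC ripZl. Qed.

Lemma ripNr x z : rip x (- z) = - rip x z.
Proof. by rewrite ![rip x _]ripC ripNl. Qed.

Definition ripE := (ripDl, ripDr, ripNl, ripNr, ripZl, ripZr).

Lemma rip_scale a x y : rip (a *: x) y = rip x (a^* *: y).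
Proof. by rewrite /rip ipZl ipZr conjCK. Qed.

Lemma rip_ge0 x : 0 <= rip x x.
Proof. by have [_ _ pos _ _] := hH; have := pos x; rewrite lecE => /andP[]. Qed.

Lemma rip_eq0 x : rip x x = 0 -> x = 0.
Proof.
have [_ _ pos def _] := hH; move=> x0; apply: def.
have := pos x; rewrite lecE => /andP[/eqP im _].
by move: im x0; rewrite /rip; case: (ip x x) => a b /= -> ->.
Qed.

Lemma rip_ext x y : (forall z, rip x z = rip y z) -> x = y.
Proof.
move=> xy; apply/eqP; rewrite -subr_eq0; apply/eqP/rip_eq0.
by rewrite ripDl ripNl xy subrr.
Qed.

Lemma nm_sq x : nm x ^+ 2 = rip x x.
Proof. by rewrite sqr_sqrtr // rip_ge0. Qed.

Lemma nm_ge0 x : 0 <= nm x.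
Proof. exact: sqrtr_ge0. Qed.
Hint Resolve nm_ge0 : core.

Lemma nm0 : nm 0 = 0.
Proof. by rewrite /hnorm ip0l sqrtr0. Qed.

Lemma nm_eq0 x : nm x = 0 -> x = 0.
Proof. by move=> x0; apply: rip_eq0; rewrite -nm_sq x0 expr0n. Qed.

Lemma nm_le_sq x (k : R) : 0 <= k -> rip x x <= k ^+ 2 -> nm x <= k.
Proof. by move=> k0; rewrite -nm_sq ler_sqr // nnegrE. Qed.

Lemma nm_eq_sq x y : rip x x = rip y y -> nm x = nm y.
Proof. by rewrite /hnorm -!/(rip _ _) => ->. Qed.

Lemma nmN x : nm (- x) = nm x.
Proof. by apply: nm_eq_sq; rewrite !ripE opprK. Qed.

Lemma nm_sub x y : nm (x - y) = nm (y - x).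
Proof. by rewrite -opprB nmN. Qed.

Lemma nmZ (r : R) x : nm (r%:C%C *: x) = `|r| * nm x.
Proof.
rewrite /hnorm -!/(rip _ _) !ripE mulrA -expr2 sqrtrM ?sqr_ge0 //.
by rewrite sqrtr_sqr.
Qed.

Lemma nm_scale_bound a : exists k : R, forall x, nm (a *: x) <= k * nm x.
Proof.
exists (Num.sqrt (complex.Re (a^* * a))) => x.
have aa : (a^* * a) = (complex.Re (a^* * a))%:C%C.
  by rewrite mulrC; case: a => a b; congr (_ +i* _)%C => /=; ring.
have a0 : 0 <= complex.Re (a^* * a).
  by rewrite mulrC; case: {aa} a => a b /=; have := sqr_ge0 a; have := sqr_ge0 b; lra.
apply: nm_le_sq; first by rewrite mulr_ge0 ?sqrtr_ge0.
by rewrite exprMn sqr_sqrtr // nm_sq -ripZr -aa rip_scale scalerA.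
Qed.

Lemma cauchy_schwarz x y : rip x y <= nm x * nm y.
Proof.
have [->|x0] := eqVneq x 0; first by rewrite /rip ip0l nm0 mul0r.
have [->|y0] := eqVneq y 0.
  by rewrite ripC /rip ip0l nm0 mulr0.
have nx : 0 < nm x.
  by rewrite lt_def nm_ge0 andbT; apply: contraNneq x0 => /nm_eq0 ->.
have ny : 0 < nm y.
  by rewrite lt_def nm_ge0 andbT; apply: contraNneq y0 => /nm_eq0 ->.
(* This square equals [2 |x| |y| (|x| |y| - rip x y)]. *)
have := rip_ge0 ((nm y)%:C%C *: x - (nm x)%:C%C *: y).
rewrite !ripE (ripC y x) -!nm_sq => h.
have {}h : 0 <= (2 * (nm x * nm y)) * (nm x * nm y - rip x y).
  by apply: le_trans h _; rewrite le_eqVlt; apply/orP; left; apply/eqP; ring.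
by move: h; rewrite pmulr_rge0 ?mulr_gt0 // subr_ge0.
Qed.

Lemma norm_rip_le x y : `|rip x y| <= nm x * nm y.
Proof.
rewrite ler_norml cauchy_schwarz andbT lerNl -ripNl -[nm x]nmN.
exact: cauchy_schwarz.
Qed.

Lemma nmD x y : nm (x + y) <= nm x + nm y.
Proof.
apply: nm_le_sq; first by rewrite addr_ge0.
rewrite !ripE (ripC y x) -!nm_sq sqrrD.
by have := cauchy_schwarz x y; lra.
Qed.

Lemma nm_triangle y x z : nm (x - z) <= nm (x - y) + nm (y - z).
Proof. by apply: le_trans (nmD _ _); rewrite addrA subrK. Qed.

Lemma nm_le_dist x y : nm x <= nm y + nm (x - y).
Proof. by rewrite addrC; apply: le_trans (nmD _ _); rewrite subrK. Qed.

Lemma nm_le_of_rip x (K : R) : 0 <= K ->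
  (forall w, rip x w <= K * nm w) -> nm x <= K.
Proof.
move=> K0 /(_ x); rewrite -nm_sq expr2 => h.
have [/eqP ->//|x0] := boolP (nm x == 0).
by rewrite -(ler_pM2r (_ : 0 < nm x)) // lt_def x0 nm_ge0.
Qed.

(* [l] is represented by the minimiser of [rip w w - 2 * l w]; minimising
   sequences are Cauchy by the parallelogram law. *)
Lemma riesz (l : H -> R) (K : R) :
  (forall x y, l (x + y) = l x + l y) ->
  (forall (r : R) x, l (r%:C%C *: x) = r * l x) ->
  (forall x, `|l x| <= K * nm x) ->
  exists u, forall w, rip u w = l w.
Proof.
move=> lD lZ lK.
have lN x : l (- x) = - l x.
  have -> : - x = (-1 : R)%:C%C *: x by apply: rip_ext => z; rewrite !ripE mulN1r.
  by rewrite lZ mulN1r.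
pose J w := rip w w - 2 * l w.
pose S := [set J w | w in setT]%classic.
(* Complete the square: [J w >= |w|^2 - 2 K |w| >= - K^2]. *)
have Jlb w : - K ^+ 2 <= J w.
  rewrite /J -nm_sq; have := lK w; rewrite ler_norml => /andP[_ h].
  have := sqr_ge0 (nm w - K); rewrite sqrrB; lra.
have S0 : (S !=set0)%classic by exists (J 0), 0.
have Slb : has_lbound S by exists (- K ^+ 2) => _ [w _ <-].
pose d := inf S.
have dJ w : d <= J w by apply: ge_inf => //; exists w.
have Jd (e : R) : 0 < e -> exists w, J w < d + e.
  by move=> e0; have [_ [w _ <-] h] := inf_adherent e0 (conj S0 Slb); exists w.
pose wn (n : nat) := xget 0 [set w | J w < d + n.+1%:R^-1]%classic.
have wnP n : J (wn n) < d + n.+1%:R^-1.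
  have /Jd[w hw] : 0 < n.+1%:R^-1 :> R by rewrite invr_gt0 ltr0n.
  exact: (@xgetI _ 0 [set w | J w < d + n.+1%:R^-1]%classic _ hw).
have close w w' (e e' : R) : J w < d + e -> J w' < d + e' ->
    rip (w - w') (w - w') <= 2 * (e + e').
  move=> h h'.
  have := dJ ((2^-1 : R)%:C%C *: (w + w')).
  rewrite /J lZ lD in h h' * ; move: h h'; rewrite !ripE (ripC w' w); lra.
have inv_small (e : R) : 0 < e -> exists N : nat, forall n, (N <= n)%N -> n.+1%:R^-1 < e.
  move=> e0; exists (Num.trunc e^-1) => n Nn.
  rewrite invf_plt ?posrE ?ltr0n //; apply: lt_le_trans (truncnS_gt _) _.
  by rewrite ler_nat ltnS.
have [_ _ _ _ complete] := hH.
have [e e0|u uP] := complete wn.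
  have [|N hN] := inv_small (e ^+ 2 / 4); first by have := exprn_gt0 2 e0; lra.
  exists N => m n Nm Nn.
  rewrite -ltr_sqr ?nnegrE // ?(ltW e0) // nm_sq.
  apply: le_lt_trans (close _ _ _ _ (wnP m) (wnP n)) _.
  have := hN _ Nm; have := hN _ Nn.
  by move: (m.+1%:R^-1) (n.+1%:R^-1) => a b; lra.
exists u => w.
(* First variation at the minimiser: compare [J (wn n + t w) >= d] with [J (wn n) < d + 1/(n+1)] and
   let [wn n] tend to [u]. *)
have small (t e : R) : 0 < e -> - e <= t ^+ 2 * rip w w + 2 * t * (rip u w - l w).
  move=> e0.
  have K0 : 0 < 2 * `|t| * nm w + 1 by have := mulr_ge0 (normr_ge0 t) (nm_ge0 w); lra.
  have [|N1 h1] := uP (e / 2 / (2 * `|t| * nm w + 1)); first by rewrite !divr_gt0.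
  have [|N2 h2] := inv_small (e / 2); first by rewrite divr_gt0.
  pose n := maxn N1 N2.
  have {}h1 := h1 n (leq_maxl _ _); have {}h2 := h2 n (leq_maxr _ _).
  have hn := wnP n; have := dJ (wn n + t%:C%C *: w).
  rewrite /J lD lZ in hn *; move: hn; rewrite !ripE (ripC w (wn n)) => hn hd.
  have hh : `|2 * t * (rip (wn n) w - rip u w)| <= e / 2.
    rewrite !normrM (ger0_norm (_ : 0 <= 2 :> R)) //.
    rewrite -ripNl -ripDl; apply: (@le_trans _ _ (2 * `|t| * (nm (wn n - u) * nm w))).
      by apply: ler_wpM2l; [rewrite mulr_ge0|apply: norm_rip_le].
    move: h1; rewrite ltr_pdivlMr // => h1.
    have -> : 2 * `|t| * (nm (wn n - u) * nm w) = nm (wn n - u) * (2 * `|t| * nm w) by ring.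
    by have := nm_ge0 (wn n - u); move: h1; rewrite mulrDr mulr1; lra.
  move: hh h2 hn hd; rewrite ler_norml; move: (n.+1%:R^-1) (wn n) => q v.
  by move=> /andP[_ hh] h2 hn hd; lra.
have {}small (t : R) : 0 <= t ^+ 2 * rip w w + 2 * t * (rip u w - l w).
  rewrite leNgt; apply/negP => neg.
  have := small t (- (t ^+ 2 * rip w w + 2 * t * (rip u w - l w)) / 2) ltac:(lra).
  lra.
apply/eqP; rewrite -subr_eq0; set c := rip u w - l w in small *.
have ww := rip_ge0 w.
(* A nearly optimal [t]; the [+ 1] keeps the denominator positive even for [w = 0], and the
   quadratic is still negative there unless [c = 0]. *)
have := small (- c / (rip w w + 1)).
have -> : (- c / (rip w w + 1)) ^+ 2 * rip w w + 2 * (- c / (rip w w + 1)) * c =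
  - (c / (rip w w + 1)) ^+ 2 * (rip w w + 2).
  by field; rewrite gt_eqF //; lra.
rewrite mulNr oppr_ge0 pmulr_lle0; last by lra.
move=> h; have := sqr_ge0 (c / (rip w w + 1)) => h'.
have /eqP : (c / (rip w w + 1)) ^+ 2 = 0 by apply/eqP; rewrite eq_le h.
rewrite expf_eq0 /= mulf_eq0 invr_eq0 => /orP[//|/eqP]; lra.
Qed.

(** * Operators, adjoints and limits with a geometric rate *)

Definition lin (T : H -> H) :=
  forall (a : R[i]) x y, T (a *: x + y) = a *: T x + T y.
(** Tests real parts only; [adj_ip] recovers the complex relation for linear [T]. *)
Definition adj (T S : H -> H) := forall x y, rip (T x) y = rip x (S y).
(** Pointwise form of [hs_opnorm <= c], which avoids any supremum. *)
Definition bop (c : R) (T : H -> H) := forall v, nm (T v) <= c * nm v.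

Lemma linD T x y : lin T -> T (x + y) = T x + T y.
Proof. by move=> lT; rewrite -[x]scale1r lT !scale1r. Qed.

Lemma lin0 T : lin T -> T 0 = 0.
Proof. by move=> lT; apply: (addrI (T 0)); rewrite -linD // !addr0. Qed.

Lemma linZ T a x : lin T -> T (a *: x) = a *: T x.
Proof. by move=> lT; rewrite -[a *: x]addr0 lT lin0 // addr0. Qed.

Lemma linN T x : lin T -> T (- x) = - T x.
Proof. by move=> lT; rewrite -scaleN1r linZ // scaleN1r. Qed.

Lemma linB T x y : lin T -> T (x - y) = T x - T y.
Proof. by move=> lT; rewrite linD // linN. Qed.

Lemma adj_sym T S : adj T S -> adj S T.
Proof. by move=> TS x y; rewrite ripC -TS ripC. Qed.

Lemma adj_lin T S : adj T S -> lin T -> lin S.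
Proof.
move=> TS lT a y z; apply: rip_ext => x; rewrite ![rip _ x]ripC -TS !ripDr -!TS.
by congr (_ + _); rewrite -{1}[a]conjCK -rip_scale -linZ // TS rip_scale conjCK.
Qed.

(** Imaginary parts are real parts in disguise, [Im (ip u v) = - rip (i u) v], and [T] commutes with
    [i]. *)
Lemma adj_ip T S x y : adj T S -> lin T -> ip (T x) y = ip x (S y).
Proof.
move=> TS lT.
have im u v : complex.Im (ip u v) = - rip ('i%C *: u) v.
  by rewrite /rip ipZl; case: (ip u v) => a b /=; rewrite mul0r mul1r sub0r opprK.
have := TS x y; have := TS ('i%C *: x) y; rewrite linZ // /adj => h1 h2.
have {h1} : complex.Im (ip (T x) y) = complex.Im (ip x (S y)) by rewrite !im h1.
move: h2; rewrite /rip.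
by case: (ip (T x) y) (ip x (S y)) => [a b] [c d] /= -> ->.
Qed.

Lemma isometry_of_adj U V : adj U V -> cancel U V -> forall v, nm (U v) = nm v.
Proof. by move=> UV UK v; apply: nm_eq_sq; rewrite UV UK. Qed.

(** Bernoulli's inequality cleared of denominators; it yields [r^n <= 1 / (1 + n (1 - r))]. *)
Lemma bernoulli_pow (r : R) (n : nat) : 0 <= r -> r < 1 ->
  r ^+ n * (1 + n%:R * (1 - r)) <= 1.
Proof.
move=> r0 r1; elim: n => [|n IHn]; first by rewrite expr0 mul0r; lra.
apply: le_trans IHn; rewrite exprSr -mulrA; apply: ler_wpM2l.
  exact: exprn_ge0.
rewrite -addn1 natrD.
have d0 : 0 <= 1 - r by lra.
have : 0 <= (1 - r) * (1 - r) * (n%:R + 1).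
  by rewrite !mulr_ge0 // addr_ge0.
by move: (n%:R : R) => m; lra.
Qed.

Lemma pow_small (r e : R) : 0 <= r -> r < 1 -> 0 < e -> exists n, r ^+ n < e.
Proof.
move=> r0 r1 e0; pose n := (Num.trunc (e^-1 / (1 - r))).+1; exists n.
have d0 : 0 < 1 - r by lra.
have : e^-1 < n%:R * (1 - r) by rewrite -ltr_pdivrMr // truncnS_gt.
have := bernoulli_pow r n r0 r1; have := exprn_ge0 n r0.
move: (r ^+ n) (n%:R * (1 - r)) => p q p0 h1 h2.
have q0 : 0 < 1 + q by have : 0 < e^-1 by [rewrite invr_gt0]; lra.
apply: (@le_lt_trans _ _ (1 + q)^-1); first by rewrite -[_^-1]mul1r ler_pdivlMr.
by rewrite invf_plt ?posrE //; lra.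
Qed.

Lemma le_of_geo (x y K r : R) : 0 <= r -> r < 1 ->
  (forall n, x <= y + K * r ^+ n) -> x <= y.
Proof.
move=> r0 r1 h; rewrite leNgt; apply/negP => yx.
have K0 : 0 < `|K| + 1 by rewrite ltr_wpDl.
have [|n hn] := pow_small r ((x - y) / (`|K| + 1)) r0 r1.
  by rewrite divr_gt0 // subr_gt0.
have := h n; move: hn; rewrite ltr_pdivlMr // => hn.
have : K * r ^+ n <= r ^+ n * (`|K| + 1).
  rewrite mulrC; apply: ler_wpM2l; first exact: exprn_ge0.
  by have := ler_norm K; lra.
lra.
Qed.

Lemma eq_of_geo (x y : H) (K r : R) : 0 <= r -> r < 1 ->
  (forall n, nm (x - y) <= K * r ^+ n) -> x = y.
Proof.
move=> r0 r1 h; apply/eqP; rewrite -subr_eq0; apply/eqP/nm_eq0/eqP.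
rewrite eq_le nm_ge0 andbT; apply: (le_of_geo _ _ K r) => // n.
by rewrite add0r.
Qed.

Lemma geo_cvg (u : nat -> H) (c r : R) : 0 <= c -> 0 <= r -> r < 1 ->
  (forall n, nm (u n.+1 - u n) <= c * r ^+ n) ->
  exists l, forall n, nm (u n - l) <= c / (1 - r) * r ^+ n.
Proof.
move=> c0 r0 r1 h; have d0 : 0 < 1 - r by lra.
have tail n k : nm (u (n + k)%N - u n) <= c / (1 - r) * r ^+ n.
  (* The exact partial geometric sum, unlike the weaker bound by [r^n], passes through the induction
     on [k]. *)
  apply: (@le_trans _ _ (c / (1 - r) * (r ^+ n - r ^+ (n + k)))); last first.
    apply: ler_wpM2l; first by rewrite divr_ge0 // ltW.
    by have := exprn_ge0 (n + k) r0; lra.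
  elim: k => [|k IHk]; first by rewrite addn0 !subrr nm0 mulr0.
  apply: le_trans (nm_triangle (u (n + k)%N) _ _) _; rewrite addnS.
  apply: le_trans (lerD (h _) IHk) _.
  rewrite le_eqVlt; apply/orP; left; apply/eqP; rewrite [r ^+ (n + k).+1]exprS.
  by field; rewrite gt_eqF.
have [_ _ _ _ complete] := hH.
have c1 : 0 <= c / (1 - r) by rewrite divr_ge0 // ltW.
have [e e0|l lP] := complete u.
  have [|N hN] := pow_small r (e / 2 / (c / (1 - r) + 1)) r0 r1.
    by rewrite !divr_gt0 //; lra.
  have hN' : c / (1 - r) * r ^+ N < e / 2.
    move: hN; rewrite ltr_pdivlMr; last by lra.
    by rewrite mulrDr mulr1 mulrC; have := exprn_ge0 N r0; lra.
  exists N => m n Nm Nn.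
  apply: le_lt_trans (nm_triangle (u N) _ _) _; rewrite [nm (u N - _)]nm_sub.
  have := tail N (m - N)%N; have := tail N (n - N)%N; rewrite !subnKC //; lra.
exists l => n; apply/ler_addgt0Pr => e e0.
have [N hN] := lP e e0.
apply: le_trans (nm_triangle (u (n + N)%N) _ _) _; apply: lerD.
  by rewrite nm_sub; apply: tail.
by apply/ltW/hN; apply: leq_addl.
Qed.

(** Operator-norm convergence with its rate built in, so that limit identities reduce to [eq_of_geo]
    and [le_of_geo]. *)
Definition olim (K r : R) (Tn : nat -> H -> H) (T : H -> H) :=
  forall n v, nm (Tn n v - T v) <= K * r ^+ n * nm v.

Lemma olim_exists (Tn : nat -> H -> H) (c r : R) : 0 <= c -> 0 <= r -> r < 1 ->
  (forall n v, nm (Tn n.+1 v - Tn n v) <= c * r ^+ n * nm v) ->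
  exists T, olim (c / (1 - r)) r Tn T.
Proof.
move=> c0 r0 r1 h.
have /choice[T TP] : forall v, exists l, forall n,
    nm (Tn n v - l) <= c / (1 - r) * r ^+ n * nm v.
  move=> v; have [|n|l lP] := geo_cvg (Tn ^~ v) (c * nm v) r _ r0 r1.
  - by rewrite mulr_ge0.
  - by have := h n v; rewrite mulrAC.
  - by exists l => n; have := lP n; rewrite [c * _ / _]mulrAC [X in _ <= X]mulrAC.
by exists T => n v; apply: TP.
Qed.

Section Limits.
Variables (K r : R) (Tn Sn : nat -> H -> H) (T S : H -> H).
Hypotheses (r0 : 0 <= r) (r1 : r < 1).
Hypotheses (TnT : olim K r Tn T) (SnS : olim K r Sn S).

Lemma olim_lin : (forall n, lin (Tn n)) -> lin T.
Proof.
move=> lT a x y; have [k kP] := nm_scale_bound a.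
have k0 : 0 <= `|k| by [].
apply: (eq_of_geo _ _ (K * nm (a *: x + y) + `|k| * (K * nm x) + K * nm y) r) => // n.
have -> : T (a *: x + y) - (a *: T x + T y) =
    (T (a *: x + y) - Tn n (a *: x + y)) + a *: (Tn n x - T x) + (Tn n y - T y).
  rewrite lT scalerBr; apply: rip_ext => z; rewrite !ripE; ring.
apply: le_trans (nmD _ _) _; rewrite !mulrDl; apply: lerD; last first.
  by apply: le_trans (TnT _ _) _; rewrite mulrAC.
apply: le_trans (nmD _ _) _; apply: lerD.
  by rewrite nm_sub; apply: le_trans (TnT _ _) _; rewrite mulrAC.
apply: le_trans (kP _) _; apply: (@le_trans _ _ (`|k| * nm (Tn n x - T x))).
  by apply: ler_wpM2r => //; apply: ler_norm.
rewrite -mulrA; apply: ler_wpM2l => //.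
by apply: le_trans (TnT _ _) _; rewrite mulrAC.
Qed.

Lemma olim_adj : (forall n, adj (Tn n) (Sn n)) -> adj T S.
Proof.
move=> TS x y; apply/eqP; rewrite -subr_eq0 -normr_le0.
apply: (le_of_geo _ _ (2 * (K * nm x * nm y)) r) => // n.
have -> : rip (T x) y - rip x (S y) =
    - rip (Tn n x - T x) y + rip x (Sn n y - S y).
  by rewrite !ripE -TS; ring.
rewrite add0r; apply: le_trans (ler_normD _ _) _; rewrite normrN.
have h1 : `|rip (Tn n x - T x) y| <= K * r ^+ n * nm x * nm y.
  by apply: le_trans (norm_rip_le _ _) _; apply: ler_wpM2r.
have h2 : `|rip x (Sn n y - S y)| <= nm x * (K * r ^+ n * nm y).
  by apply: le_trans (norm_rip_le _ _) _; apply: ler_wpM2l.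
lra.
Qed.

(** [S (T v) - v] is split at [Sn (T v)] and [Sn (Tn v)]. The middle difference is
    [Sn (T v - Tn v)], where the bound on [Sn] uniform in [n] enters. *)
Lemma olim_cancel (c d : R) : (forall n, lin (Sn n)) -> (forall n, bop c (Sn n)) ->
  (forall n v, nm (v - Sn n (Tn n v)) <= d * r ^+ n * nm v) -> cancel T S.
Proof.
move=> lS bS ST v.
apply: (eq_of_geo _ _ (K * nm (T v) + `|c| * (K * nm v) + d * nm v) r) => // n.
have -> : S (T v) - v =
    (S (T v) - Sn n (T v)) + Sn n (T v - Tn n v) + (Sn n (Tn n v) - v).
  rewrite (linB (Sn n)) //; apply: rip_ext => z; rewrite !ripE; ring.
apply: le_trans (nmD _ _) _; rewrite !mulrDl; apply: lerD; last first.
  by rewrite nm_sub; apply: le_trans (ST _ _) _; rewrite mulrAC.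
apply: le_trans (nmD _ _) _; apply: lerD.
  by rewrite nm_sub; apply: le_trans (SnS _ _) _; rewrite mulrAC.
apply: le_trans (bS _ _) _; apply: (@le_trans _ _ (`|c| * nm (Tn n v - T v))).
  by rewrite nm_sub; apply: ler_wpM2r => //; apply: ler_norm.
rewrite -mulrA; apply: ler_wpM2l => //.
by apply: le_trans (TnT _ _) _; rewrite mulrAC.
Qed.

Lemma olim_bop (c : R) : (forall n, bop c (Tn n)) -> bop c T.
Proof.
move=> bT v; apply: (le_of_geo _ _ (K * nm v) r) => // n.
apply: le_trans (nm_le_dist _ (Tn n v)) _; apply: lerD; first exact: bT.
by rewrite nm_sub; apply: le_trans (TnT _ _) _; rewrite mulrAC.
Qed.

End Limits.

(** * Unitary part of a nearly unitary operator *)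

(** This is [A (3 - B A) / 2], the Newton-Schulz step for the polar factor when [B] is the adjoint
    of [A]. *)
Definition newton_schulz (A B : H -> H) (v : H) : H :=
  A (v + (2^-1 : R)%:C%C *: (v - B (A v))).

Lemma comp_defect_lin A B : lin A -> lin B -> lin (fun v => v - B (A v)).
Proof.
move=> lA lB a x y; rewrite lA lB scalerBr.
by apply: rip_ext => z; rewrite !ripE; ring.
Qed.

Lemma newton_schulz_lin A B : lin A -> lin B -> lin (newton_schulz A B).
Proof.
move=> lA lB a x y; rewrite /newton_schulz (comp_defect_lin A B lA lB) -lA.
congr A; rewrite !scalerDr !scalerA ![a * _]mulrC.
by apply: rip_ext => z; rewrite !ripDl; ring.
Qed.

Lemma newton_schulz_adj A B : lin A -> lin B -> adj A B ->
  adj (newton_schulz A B) (newton_schulz B A).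
Proof.
move=> lA lB AB v w; rewrite /newton_schulz AB (linD B) // (linZ B) // (linB B) //.
by rewrite !ripE (adj_sym _ _ AB) AB.
Qed.

(* With [D = 1 - BA], the new defect is [3/4 D^2 + 1/4 D^3]. *)
Lemma newton_schulz_defect A B (d : R) : lin A -> lin B -> 0 <= d -> d <= 4^-1 ->
  bop d (fun v => v - B (A v)) ->
  bop (d / 4) (fun v => v - newton_schulz B A (newton_schulz A B v)).
Proof.
move=> lA lB d0 d4; set D := fun v => v - B (A v) => bD v.
have lD : lin D by apply: comp_defect_lin.
have DE x : x - B (A x) = D x by [].
have BA x : B (A x) = x - D x by rewrite /D opprB addrC subrK.
clearbody D.
have -> : v - newton_schulz B A (newton_schulz A B v) =
    (3 / 4 : R)%:C%C *: D (D v) + (4^-1 : R)%:C%C *: D (D (D v)).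
  rewrite /newton_schulz DE (linD B) // (linZ B) // (linB B) // !BA.
  rewrite !(linD D, linN D, linZ D) //.
  by apply: rip_ext => z; rewrite !ripE; field.
apply: le_trans (nmD _ _) _; rewrite !nmZ !ger0_norm; try lra.
(* For [d <= 1/4], [3/4 d^2 + 1/4 d^3 <= (3/16 + 1/64) d <= d/4]. *)
have h1 := bD v; have h2 := bD (D v); have h3 := bD (D (D v)).
have n0 := nm_ge0 v.
have k1 := ler_wpM2l d0 h1.
have k2 := ler_wpM2l d0 (le_trans h2 k1).
have k3 := ler_wpM2r (mulr_ge0 d0 n0) d4.
have k4 := ler_wpM2l d0 k3.
have k5 := mulr_ge0 d0 n0.
lra.
Qed.

(** [|A v|^2 = rip v (B (A v)) <= (1 + d) |v|^2], and [51/50 <= (11/10)^2]. *)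
Lemma adj_bound A B (d : R) : adj A B -> 0 <= d -> d <= 50^-1 ->
  bop d (fun v => v - B (A v)) -> bop (11 / 10) A.
Proof.
move=> AB d0 d1 bD v; apply: nm_le_sq; first by have := nm_ge0 v; lra.
rewrite AB; apply: le_trans (cauchy_schwarz _ _) _.
have := nm_le_dist (B (A v)) v; rewrite nm_sub => h1.
have n0 := nm_ge0 v; have h2 := ler_wpM2r n0 d1.
have : nm v * nm (B (A v)) <= nm v * (51 / 50 * nm v).
  by apply: ler_wpM2l => //; have := bD v; lra.
have := sqr_ge0 (nm v); rewrite exprMn expr2; lra.
Qed.

Lemma newton_schulz_dist A B (d : R) : lin A -> bop (11 / 10) A -> 0 <= d ->
  bop d (fun v => v - B (A v)) ->
  bop (11 / 20 * d) (fun v => newton_schulz A B v - A v).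
Proof.
move=> lA bA d0 bD v.
rewrite /newton_schulz -(linB A) // addrC addKr.
apply: le_trans (bA _) _; rewrite nmZ ger0_norm; last by lra.
by have := bD v; lra.
Qed.

(* The Newton-Schulz iteration converges to the unitary part of the polar
   decomposition of [A], without ever inverting an operator. *)
Lemma unitarize A B (d : R) : lin A -> adj A B -> 0 <= d -> d <= 50^-1 ->
  bop d (fun v => v - B (A v)) -> bop d (fun v => v - A (B v)) ->
  exists U V, [/\ lin U, adj U V, cancel U V, cancel V U &
    bop d (fun v => U v - A v)].
Proof.
move=> lA AB d0 d1 bBA bAB.
(* The second component remains the adjoint of the first, so [1 - BA] and [1 - AB] shrink together
   and the limit is invertible on both sides. *)
pose P n := iter n (fun X : (H -> H) * (H -> H) =>
  (newton_schulz X.1 X.2, newton_schulz X.2 X.1)) (A, B).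
have q0 : 0 <= 4^-1 :> R by lra.
have q1 : 4^-1 < 1 :> R by lra.
have dn n : 0 <= d * 4^-1 ^+ n /\ d * 4^-1 ^+ n <= 50^-1.
  split; first by rewrite mulr_ge0 // exprn_ge0.
  apply: le_trans d1; rewrite -[X in _ <= X]mulr1; apply: ler_wpM2l => //.
  by rewrite exprn_ile1 // ltW.
have inv n : [/\ lin (P n).1, lin (P n).2, adj (P n).1 (P n).2,
    bop (d * 4^-1 ^+ n) (fun v => v - (P n).2 ((P n).1 v)) &
    bop (d * 4^-1 ^+ n) (fun v => v - (P n).1 ((P n).2 v))].
  elim: n => [|n [l1 l2 a12 b1 b2]].
    by rewrite expr0 mulr1; split=> //; apply: adj_lin AB lA.
  have [e0 e1] := dn n.
  rewrite exprSr mulrA /=; split.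
  - exact: newton_schulz_lin.
  - exact: newton_schulz_lin.
  - exact: newton_schulz_adj.
  - by apply: newton_schulz_defect => //; lra.
  - by apply: newton_schulz_defect => //; lra.
have bnd n : bop (11 / 10) (P n).1 /\ bop (11 / 10) (P n).2.
  have [l1 l2 a12 b1 b2] := inv n; have [e0 e1] := dn n.
  by split; [apply: adj_bound b1|apply: adj_bound b2 => //; apply: adj_sym].
have c0 : 0 <= 11 / 20 * d by lra.
have [U UP] : exists U, olim (11 / 20 * d / (1 - 4^-1)) 4^-1 (fun n => (P n).1) U.
  apply: olim_exists => // n v.
  have [l1 l2 a12 b1 b2] := inv n; have [e0 e1] := dn n; have [B1 _] := bnd n.
  by rewrite -[_ * d * _]mulrA; apply: (newton_schulz_dist (P n).1 (P n).2).
have [V VP] : exists V, olim (11 / 20 * d / (1 - 4^-1)) 4^-1 (fun n => (P n).2) V.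
  apply: olim_exists => // n v.
  have [l1 l2 a12 b1 b2] := inv n; have [e0 e1] := dn n; have [_ B2] := bnd n.
  by rewrite -[_ * d * _]mulrA; apply: (newton_schulz_dist (P n).2 (P n).1).
exists U, V; split.
- by apply: olim_lin q0 q1 UP _ => n; have [] := inv n.
- by apply: olim_adj q0 q1 UP VP _ => n; have [] := inv n.
- apply: (olim_cancel _ _ _ _ _ _ q0 q1 UP VP (11 / 10) d) => n; first by have [] := inv n.
    by have [] := bnd n.
  by have [] := inv n.
- apply: (olim_cancel _ _ _ _ _ _ q0 q1 VP UP (11 / 10) d) => n; first by have [] := inv n.
    by have [] := bnd n.
  by have [] := inv n.
move=> v; rewrite nm_sub; apply: le_trans (UP 0%N v) _.
(* The total displacement is [(11/20) d / (1 - 1/4) = (11/15) d]. *)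
rewrite expr0 mulr1; apply: ler_wpM2r => //.
by rewrite ler_pdivrMr; lra.
Qed.

(** * Weak means of vector functions bounded on [Gam] *)

Section VectorMean.
Variables (L : groupType) (Gam : {pred L}) (I : (L -> R) -> R).
Hypothesis gG : group_closed Gam.
Local Notation bnd := (bounded_on R L [set` Gam]%classic).
Hypothesis ID : forall f g, bnd f -> bnd g -> I (fun x => f x + g x) = I f + I g.
Hypothesis IZ : forall f r, bnd f -> I (fun x => r * f x) = r * I f.
Hypothesis I_le : forall f K, {in Gam, forall x, `|f x| <= K} -> `|I f| <= K.
Hypothesis I_cst : forall c, I (fun=> c) = c.
Hypothesis I_trans : forall f g, g \in Gam -> bnd f -> I (fun x => f (x * g)%g) = I f.
Hypothesis eq_I : forall f g, {in Gam, f =1 g} -> I f = I g.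

Definition vbounded (f : L -> H) := exists K : R, {in Gam, forall x, nm (f x) <= K}.

(** A Pettis-type integral. For [f] bounded on [Gam] the vector exists by [riesz]; the default 0 is
    returned when there is none. *)
Definition vmean (f : L -> H) : H :=
  xget 0 [set u | forall w, rip u w = I (fun x => rip (f x) w)]%classic.

Lemma vbounded_rip f w : vbounded f -> bnd (fun x => rip (f x) w).
Proof.
move=> [K fK]; exists (K * nm w) => x /= xG.
by apply: le_trans (norm_rip_le _ _) _; apply: ler_wpM2r => //; apply: fK.
Qed.

Lemma rip_vmean f w : vbounded f -> rip (vmean f) w = I (fun x => rip (f x) w).
Proof.
move=> bf; apply: (@xgetPex _ 0
  [set u | forall w, rip u w = I (fun x => rip (f x) w)]%classic).
have [K fK] := bf; apply: (riesz _ K).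
- move=> x y; rewrite -ID; try exact: vbounded_rip.
  by apply: eq_I => z _; rewrite ripDr.
- move=> r x; rewrite -IZ; try exact: vbounded_rip.
  by apply: eq_I => z _; rewrite ripZr.
move=> x; apply: I_le => z zG.
by apply: le_trans (norm_rip_le _ _) _; apply: ler_wpM2r => //; apply: fK.
Qed.

Lemma vboundedD f g : vbounded f -> vbounded g -> vbounded (fun x => f x + g x).
Proof.
move=> [K fK] [M gM]; exists (K + M) => x xG.
by apply: le_trans (nmD _ _) _; apply: lerD; [apply: fK|apply: gM].
Qed.

Lemma vboundedB f g : vbounded f -> vbounded g -> vbounded (fun x => f x - g x).
Proof.
move=> bf [M gM]; apply: vboundedD => //; exists M => x xG.
by rewrite nmN; apply: gM.
Qed.

Lemma vbounded_bop c T f : bop c T -> vbounded f -> vbounded (fun x => T (f x)).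
Proof.
move=> bT [K fK]; exists (`|c| * K) => x xG; apply: le_trans (bT _) _.
apply: (@le_trans _ _ (`|c| * nm (f x))).
  by apply: ler_wpM2r => //; apply: ler_norm.
by apply: ler_wpM2l => //; apply: fK.
Qed.

Lemma vmeanD f g : vbounded f -> vbounded g ->
  vmean (fun x => f x + g x) = vmean f + vmean g.
Proof.
move=> bf bg; apply: rip_ext => w; rewrite ripDl !rip_vmean //; last exact: vboundedD.
rewrite -ID; try exact: vbounded_rip.
by apply: eq_I => x _; rewrite ripDl.
Qed.

Lemma vmean_adj T S f c : adj T S -> bop c T -> vbounded f ->
  vmean (fun x => T (f x)) = T (vmean f).
Proof.
move=> TS bT bf; apply: rip_ext => w; rewrite TS !rip_vmean //.
  by apply: eq_I => x _; rewrite TS.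
exact: vbounded_bop bT bf.
Qed.

(** [I] sees only real scalars; a complex [a] is handled as an operator whose adjoint is
    multiplication by its conjugate. *)
Lemma vmeanZ a f : vbounded f -> vmean (fun x => a *: f x) = a *: vmean f.
Proof.
have [k kP] := nm_scale_bound a.
by apply: (vmean_adj (fun v => a *: v) (fun v => a^* *: v) f k) => // x y; apply: rip_scale.
Qed.

Lemma vmeanB f g : vbounded f -> vbounded g ->
  vmean (fun x => f x - g x) = vmean f - vmean g.
Proof.
move=> bf [K gK]; have bg : vbounded g by exists K.
rewrite vmeanD //; last by exists K => x xG; rewrite nmN; apply: gK.
congr (_ + _); rewrite -scaleN1r -vmeanZ //; congr vmean.
by apply/funext => x; rewrite scaleN1r.
Qed.

Lemma nm_vmean_le f K : {in Gam, forall x, nm (f x) <= K} -> nm (vmean f) <= K.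
Proof.
move=> fK; have bf : vbounded f by exists K.
apply: nm_le_of_rip => [|w].
  by apply: le_trans (nm_ge0 (f 1%g)) (fK _ _); case: gG.
rewrite rip_vmean //; apply: le_trans (ler_norm _) _; apply: I_le => x xG.
by apply: le_trans (norm_rip_le _ _) _; apply: ler_wpM2r => //; apply: fK.
Qed.

Lemma vmean_cst u : vmean (fun=> u) = u.
Proof.
apply: rip_ext => w; rewrite rip_vmean; first exact: I_cst.
by exists (nm u).
Qed.

Lemma eq_vmean f g : {in Gam, f =1 g} -> vmean f = vmean g.
Proof.
move=> fg; congr xget; apply/funext => u; apply/propext.
by split=> h w; rewrite h; apply: eq_I => x xG; rewrite fg.
Qed.

Lemma vmean_trans f g : g \in Gam -> vbounded f ->
  vmean (fun x => f (x * g)%g) = vmean f.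
Proof.
move=> gGam bf; apply: rip_ext => w; rewrite !rip_vmean //; last first.
  by have [K fK] := bf; exists K => x xG; apply: fK; apply: group_closedM gG _ _ _ _.
by apply: (I_trans (fun x => rip (f x) w)) => //; apply: vbounded_rip.
Qed.

Definition almost_rep (C e : R) (p q : L -> H -> H) :=
  [/\ forall h, lin (p h), forall h, bop C (p h),
      {in Gam, forall x, [/\ adj (p x) (q x), cancel (p x) (q x) &
                             cancel (q x) (p x)]} &
      forall x h, x \in Gam -> bop e (fun v => p (x * h)%g v - p x (p h v))].

Definition avg (p q : L -> H -> H) (h : L) (v : H) : H :=
  vmean (fun x => q x (p (x * h)%g v)).

Section Averaging.
Variables (C e : R) (p q : L -> H -> H).
Hypotheses (e0 : 0 <= e) (pq : almost_rep C e p q).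

Let GM := group_closedM gG.

Lemma almost_rep_isometry x v : x \in Gam -> nm (p x v) = nm v.
Proof. by case: pq => _ _ pqx _ /pqx[? ? _]; apply: isometry_of_adj. Qed.

Lemma almost_rep_isometryV x v : x \in Gam -> nm (q x v) = nm v.
Proof.
by case: pq => _ _ pqx _ /pqx[pA _ qK]; apply: isometry_of_adj qK _; apply: adj_sym.
Qed.

Lemma avg_integrand_bound h v x : x \in Gam -> nm (q x (p (x * h)%g v)) <= C * nm v.
Proof. by move=> xG; rewrite almost_rep_isometryV //; have [_ bp _ _] := pq; apply: bp. Qed.

Lemma avg_vbounded h v : vbounded (fun x => q x (p (x * h)%g v)).
Proof. by exists (C * nm v) => x xG; apply: avg_integrand_bound. Qed.

Lemma avg_lin h : lin (avg p q h).
Proof.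
move=> a u v; have [lp _ pqx _] := pq.
have bu := avg_vbounded h u; have bv := avg_vbounded h v.
have [k kP] := nm_scale_bound a.
rewrite /avg -vmeanZ // -vmeanD //; last exact: vbounded_bop kP bu.
apply: eq_vmean => x xG; rewrite lp; have [pA _ _] := pqx x xG.
by rewrite (adj_lin _ _ pA (lp x)).
Qed.

Lemma avg_bop h : bop C (avg p q h).
Proof. by move=> v; apply: nm_vmean_le => x xG; apply: avg_integrand_bound. Qed.

Lemma avg_bop1 h : h \in Gam -> bop 1 (avg p q h).
Proof.
move=> hG v; apply: nm_vmean_le => x xG.
by rewrite almost_rep_isometryV // almost_rep_isometry ?mul1r //; apply: GM.
Qed.

Lemma avg_integrand_dist h v x : x \in Gam ->
  nm (q x (p (x * h)%g v) - p h v) <= e * nm v.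
Proof.
move=> xG; have [lp _ pqx dp] := pq; have [pA pK qK] := pqx x xG.
rewrite -[p h v]pK -(linB (q x)); last exact: adj_lin pA (lp x).
by rewrite almost_rep_isometryV //; apply: dp.
Qed.

Lemma avg_dist h : bop e (fun v => avg p q h v - p h v).
Proof.
move=> v; rewrite -[p h v]vmean_cst -vmeanB.
- by apply: nm_vmean_le => x xG; apply: avg_integrand_dist.
- exact: avg_vbounded.
- by exists (nm (p h v)).
Qed.

(** The integrand [p(x)^* p(xg)] has adjoint [p(xg)^* p(x)], which is the integrand for [g^-1] taken
    at [xg]; right-invariance absorbs the shift. *)
Lemma avg_adj g : g \in Gam -> adj (avg p q g) (avg p q g^-1%g).
Proof.
move=> gGam v w; rewrite [RHS]ripC !rip_vmean; try exact: avg_vbounded.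
rewrite -[RHS](I_trans _ g) //; last exact/vbounded_rip/avg_vbounded.
apply: eq_I => x xG; have [_ _ pqx _] := pq.
have [pA _ _] := pqx x xG; have [pgA _ _] := pqx _ (GM _ _ xG gGam).
by rewrite /= (adj_sym _ _ pA) pgA ripC mulgK.
Qed.

Lemma avg1 v : avg p q 1%g v = v.
Proof.
rewrite -[RHS]vmean_cst; apply: eq_vmean => x xG; rewrite mulg1.
by have [_ _ pqx _] := pq; have [_ pK _] := pqx x xG; apply: pK.
Qed.

(* The mean over [x] of
     [(p(x)^* p(xg) - p(g)) (p(xg)^* p(xgh) - p(h))],
   of norm at most [e^2], equals the defect of [avg] at [(g, h)] plus
   [(avg(g) - p(g)) (avg(h) - p(h))]. *)
Lemma avg_defect g h : g \in Gam ->
  bop (2 * e ^+ 2) (fun v => avg p q (g * h)%g v - avg p q g (avg p q h v)).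
Proof.
move=> gGam v; have [lp bp pqx dp] := pq.
pose k y := q y (p (y * h)%g v).
pose F x := q x (p (x * g)%g (k (x * g)%g - p h v)) - p g (k (x * g)%g - p h v).
have bk : vbounded k by apply: avg_vbounded.
have bkg : vbounded (fun x => k (x * g)%g).
  by have [K kK] := bk; exists K => x xG; apply: kK; apply: GM.
have bc (u : H) : vbounded (fun=> u) by exists (nm u).
have [gA gK _] := pqx g gGam.
have FE : vmean F = (avg p q (g * h)%g v - avg p q g (p h v)) -
    (p g (avg p q h v) - p g (p h v)).
  (* Right-invariance rewrites [avg p q h v] as the mean of [k (x * g)], so that all four terms
     become means of functions of the same [x]. *)
  rewrite -[p g (p h v)]vmean_cst -[avg p q h v](vmean_trans k g gGam bk).
  rewrite -(vmean_adj (p g) (q g) _ C gA (bp g) bkg).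
  have bpg : vbounded (fun x => p g (k (x * g)%g)) by apply: vbounded_bop bkg; apply: bp.
  rewrite -vmeanB // -vmeanB; try exact: avg_vbounded.
  rewrite -vmeanB //; try exact: vboundedB; last by apply: vboundedB; apply: avg_vbounded.
  apply: eq_vmean => x xG; have [pA pK _] := pqx x xG.
  have [xgA xgK xgK'] := pqx _ (GM _ _ xG gGam).
  rewrite /F (linB (p (x * g)%g)) // (linB (q x)); last exact: adj_lin pA (lp x).
  by rewrite (linB (p g)) // {1}/k xgK' mulgA.
have Fb : nm (vmean F) <= e * (e * nm v).
  apply: nm_vmean_le => x xG.
  apply: le_trans (avg_integrand_dist g _ x xG) _; apply: ler_wpM2l => //.
  by apply: avg_integrand_dist; apply: GM.
set w := avg p q h v - p h v.
have -> : avg p q (g * h)%g v - avg p q g (avg p q h v) =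
    vmean F - (avg p q g w - p g w).
  rewrite FE /w (linB (p g)) // (linB (avg p q g)); last exact: avg_lin.
  by apply: rip_ext => z; rewrite !ripE; ring.
apply: le_trans (nmD _ _) _; rewrite nmN.
have h1 := avg_dist g w; have h2 := ler_wpM2l e0 (avg_dist h v).
by move: h1 h2; rewrite -/w expr2; lra.
Qed.

End Averaging.

(** [V' - V = V' (U - U') V] with [V] and [V'] isometric. *)
Lemma unitary_inv_dist U V U' V' (d : R) :
  adj U V -> cancel U V -> cancel V U -> lin U' -> adj U' V' -> cancel U' V' ->
  cancel V' U' -> bop d (fun v => U' v - U v) -> bop d (fun v => V' v - V v).
Proof.
move=> UV UK VK lU' UV' UK' VK' dU v.
have -> : V' v - V v = V' (U (V v) - U' (V v)).
  by rewrite (linB V') ?VK ?UK' //; apply: adj_lin UV' lU'.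
rewrite (isometry_of_adj V' U' (adj_sym _ _ UV') VK') nm_sub.
rewrite -[nm v](isometry_of_adj V U (adj_sym _ _ UV) VK); exact: dU.
Qed.

(** * One improvement step and its iteration *)

Lemma almost_rep_improve (C e : R) (p q : L -> H -> H) :
  1 <= C -> 0 <= e -> e <= 10^-1 -> almost_rep C e p q ->
  exists P : (L -> H -> H) * (L -> H -> H),
    [/\ almost_rep C (8 * C * e ^+ 2) P.1 P.2,
        forall h, bop (e + 2 * e ^+ 2) (fun v => P.1 h v - p h v) &
        {in Gam, forall x, bop (e + 2 * e ^+ 2) (fun v => P.2 x v - q x v)}].
Proof.
move=> C1 e0 e1 pq; have [lp bp pqx dp] := pq.
have GM := group_closedM gG; have GV := group_closedV gG.
have ee0 : 0 <= e ^+ 2 by apply: sqr_ge0.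
have ee : e ^+ 2 <= 100^-1.
  by rewrite expr2; have := ler_pM e0 e0 e1 e1; lra.
have /choice[F FP] : forall x, exists X : (H -> H) * (H -> H), x \in Gam ->
    [/\ lin X.1, adj X.1 X.2, cancel X.1 X.2, cancel X.2 X.1 &
        bop (2 * e ^+ 2) (fun v => X.1 v - avg p q x v)].
  move=> x; have [xG|] := boolP (x \in Gam); last by exists (id, id).
  (* The defects of [avg] at [(x^-1, x)] and [(x, x^-1)] are exactly its failure to be unitary at
     [x]. The tolerance [50^-1] is [2 e^2] at [e = 10^-1]. *)
  have [||||v|v|U [V UVP]] := unitarize (avg p q x) (avg p q x^-1%g) (2 * e ^+ 2).
  - exact: avg_lin pq x.
  - exact: avg_adj pq x xG.
  - lra.
  - lra.
  - have := avg_defect C e p q e0 pq x^-1%g x (GV _ xG) v.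
    by rewrite mulVg (avg1 C e p q pq).
  - have := avg_defect C e p q e0 pq x x^-1%g xG v.
    by rewrite mulgV (avg1 C e p q pq).
  - by exists (U, V).
pose p' h := if h \in Gam then (F h).1 else avg p q h.
pose q' h := (F h).2.
have p'G h : h \in Gam -> p' h = (F h).1 by rewrite /p' => ->.
have p'avg h : bop (2 * e ^+ 2) (fun v => p' h v - avg p q h v).
  rewrite /p'; case: ifPn => [/FP[]//|_] v.
  by rewrite subrr nm0 mulr_ge0 //; lra.
have dist h : bop (e + 2 * e ^+ 2) (fun v => p' h v - p h v).
  move=> v; apply: le_trans (nm_triangle (avg p q h v) _ _) _.
  by have := avg_dist C e p q pq h v; have := p'avg h v; rewrite mulrDl; lra.
have lp' h : lin (p' h).
  by rewrite /p'; case: ifPn => [/FP[]//|_]; apply: avg_lin pq h.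
have iso x v : x \in Gam -> nm (p' x v) = nm v.
  by move=> xG; rewrite p'G //; have [_ ? ? _ _] := FP x xG; apply: isometry_of_adj.
exists (p', q'); split=> //=; last first.
  move=> x xG v; have [pA pK qK] := pqx x xG.
  have [lF FA FK FK' _] := FP x xG.
  apply: (unitary_inv_dist (p x) (q x) (F x).1) => // u.
  by have := dist x u; rewrite p'G.
split=> //.
- move=> h; have [hG|hG] := boolP (h \in Gam).
    move=> v; rewrite iso // -[X in X <= _]mul1r.
    exact: ler_wpM2r.
  by rewrite /p' (negbTE hG); apply: avg_bop pq h.
- by move=> x xG; rewrite p'G //; have [] := FP x xG.
move=> x h xG v.
have -> : p' (x * h)%g v - p' x (p' h v) =
    (p' (x * h)%g v - avg p q (x * h)%g v) +
    (avg p q (x * h)%g v - avg p q x (avg p q h v)) -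
    (p' x (avg p q h v) - avg p q x (avg p q h v)) -
    p' x (p' h v - avg p q h v).
  rewrite (linB (p' x)) //; apply: rip_ext => z; rewrite !ripE; ring.
have h2 := avg_defect C e p q e0 pq x h xG v.
have n0 := nm_ge0 v.
have c0 : 0 <= e ^+ 2 * nm v by rewrite mulr_ge0.
have c1 : 0 <= (C - 1) * (e ^+ 2 * nm v) by rewrite mulr_ge0 //; lra.
have h3 := p'avg x (avg p q h v).
apply: le_trans (nmD _ _) _; rewrite nmN iso //.
(* As [x] is in [Gam], [h] and [x * h] lie both inside [Gam] or both outside. Inside, the four
   differences cost [2 e^2] each; outside, the first and last vanish and [2 e^2 + 2 C e^2] remains.
   Both totals are at most [8 C e^2] since [C >= 1]. *)
have [hG|hG] := boolP (h \in Gam).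
  have h1 := p'avg (x * h)%g v; have h4 := p'avg h v.
  have h5 := ler_wpM2l ee0 (avg_bop1 C e p q pq h hG v).
  have := nmD ((p' (x * h)%g v - avg p q (x * h)%g v) +
    (avg p q (x * h)%g v - avg p q x (avg p q h v)))
    (- (p' x (avg p q h v) - avg p q x (avg p q h v))).
  have := nmD (p' (x * h)%g v - avg p q (x * h)%g v)
    (avg p q (x * h)%g v - avg p q x (avg p q h v)).
  rewrite nmN; lra.
have xhG : (x * h)%g \notin Gam.
  apply: contra hG => xhG; rewrite -[h](mulKg x); apply: GM => //.
  exact: GV.
rewrite /p' (negbTE hG) (negbTE xhG) -/(p' x) !subrr nm0 addr0 add0r.
apply: le_trans (nmD _ _) _; rewrite nmN.
have h5 := ler_wpM2l ee0 (avg_bop C e p q pq h v).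
lra.
Qed.

Lemma almost_rep_limit (C e : R) (p q : L -> H -> H) :
  1 <= C -> 0 <= e -> e <= (10 * C)^-1 -> almost_rep C e p q ->
  exists s t, almost_rep C 0 s t /\
    forall h, bop (e + 120 * C * e ^+ 2) (fun v => s h v - p h v).
Proof.
move=> C1 e0 eC pq.
have C0 : 0 < 10 * C by lra.
have eC' : 8 * C * e <= 4 / 5.
  by move: eC; rewrite -[_^-1]mul1r ler_pdivlMr //; lra.
have e1 : e <= 10^-1.
  have : 0 <= (C - 1) * e by rewrite mulr_ge0 //; lra.
  by move: eC; rewrite -[(10 * C)^-1]mul1r ler_pdivlMr //; lra.
pose en n := iter n (fun x : R => 8 * C * x ^+ 2) e.
have enS n : en n.+1 = 8 * C * en n ^+ 2 by [].
have enP n : 0 <= en n /\ en n <= e.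
  elim: n => [//|n [IH0 IH1]].
  rewrite enS expr2; have h1 := ler_pM IH0 IH0 IH1 IH1.
  have h2 : 0 <= en n * en n by rewrite mulr_ge0.
  split; first by rewrite mulr_ge0 //; lra.
  apply: (@le_trans _ _ ((8 * C * e) * e)).
    by rewrite -[X in _ <= X]mulrA; apply: ler_wpM2l => //; lra.
  by have := ler_wpM2r e0 eC'; lra.
pose r : R := 4 / 5.
have r0 : 0 <= r by rewrite /r; lra.
have r1 : r < 1 by rewrite /r; lra.
(* Each further squaring gains a factor [8 C e <= 4/5]. The bound starts at index 1, where the
   defect is already of order [e^2]. *)
have en_geo n : en n.+1 <= 8 * C * e ^+ 2 * r ^+ n.
  elim: n => [|n IHn]; first by rewrite expr0 mulr1.
  have [h0 h1] := enP n.+1.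
  rewrite enS [r ^+ n.+1]exprSr [X in _ <= X]mulrA; apply: (@le_trans _ _ (en n.+1 * r)); last exact: ler_wpM2r.
  rewrite expr2 mulrA mulrC; apply: ler_wpM2l => //.
  apply: le_trans (_ : _ <= 8 * C * e) eC'.
  by rewrite [8 * C * en _]mulrC [8 * C * e]mulrC; apply: ler_wpM2r => //; lra.
(* The improvement is chosen as a total function; the stage [n] is part of its argument because the
   guarantee refers to [en n]. *)
have /choice[f fP] : forall nP : nat * ((L -> H -> H) * (L -> H -> H)),
    exists P : (L -> H -> H) * (L -> H -> H),
    almost_rep C (en nP.1) nP.2.1 nP.2.2 ->
    [/\ almost_rep C (en nP.1.+1) P.1 P.2,
        forall h, bop (en nP.1 + 2 * en nP.1 ^+ 2) (fun v => P.1 h v - nP.2.1 h v) &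
        {in Gam, forall x,
          bop (en nP.1 + 2 * en nP.1 ^+ 2) (fun v => P.2 x v - nP.2.2 x v)}].
  move=> [n [p1 q1]] /=.
  have [pq1|npq] := pselect (almost_rep C (en n) p1 q1); last by exists (p1, q1).
  have [h0 h1] := enP n.
  have [P PP] := almost_rep_improve C (en n) p1 q1 C1 h0 (le_trans h1 e1) pq1.
  by exists P.
pose P := fix P n := if n is n'.+1 then f (n', P n') else (p, q).
have good n : almost_rep C (en n) (P n).1 (P n).2.
  by elim: n => [//|n IHn]; have [] := fP (n, P n) IHn.
have [_ dist0 _] := fP (0%N, P 0%N) (good 0%N).
(* [48/5 = 8 * 6/5]: since [en n.+1 <= 10^-1], a step [en + 2 en^2] is at most [6/5 en]. *)
have K0 : 0 <= 48 / 5 * C * e ^+ 2.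
  by have := sqr_ge0 e => ?; rewrite !mulr_ge0 //; lra.
have step_le n (x : H) :
    (en n.+1 + 2 * en n.+1 ^+ 2) * nm x <= 48 / 5 * C * e ^+ 2 * r ^+ n * nm x.
  apply: ler_wpM2r => //; have [h0 h1] := enP n.+1.
  have h2 : en n.+1 * en n.+1 <= en n.+1 * 10^-1 by apply: ler_wpM2l => //; lra.
  by have := en_geo n; rewrite expr2; lra.
(* The sequence starts at [P 1], which separates the first step, of size [e + 2 e^2], from a tail of
   order [C e^2]. *)
have /choice[s sP] : forall h, exists T,
    olim (48 / 5 * C * e ^+ 2 / (1 - r)) r (fun n => (P n.+1).1 h) T.
  move=> h; apply: olim_exists => // n v.
  have [_ d _] := fP (n.+1, P n.+1) (good n.+1).
  exact: le_trans (d h v) (step_le n v).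
have /choice[t tP] : forall h, exists T, h \in Gam ->
    olim (48 / 5 * C * e ^+ 2 / (1 - r)) r (fun n => (P n.+1).2 h) T.
  move=> h; have [hG|] := boolP (h \in Gam); last by exists id.
  have [||||T TP] := olim_exists (fun n => (P n.+1).2 h) (48 / 5 * C * e ^+ 2) r.
  - by [].
  - by [].
  - by [].
  - move=> n v; have [_ _ d] := fP (n.+1, P n.+1) (good n.+1).
    exact: le_trans (d h hG v) (step_le n v).
  - by exists T.
exists s, t; split; last first.
  move=> h v; apply: le_trans (nm_triangle ((P 1%N).1 h v) _ _) _.
  have := sP h 0%N v; rewrite nm_sub expr0 mulr1.
  (* The tail sums to [48 C e^2]; with [2 e^2 <= 2 C e^2] from the first step this is [50 C e^2],
     within the allowed [120 C e^2]. *)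
  have -> : 48 / 5 * C * e ^+ 2 / (1 - r) = 48 * C * e ^+ 2 by rewrite /r; field.
  have := dist0 h v; rewrite [en (_, _).1]/= => h1 h2.
  have h3 : 0 <= (C - 1) * (e ^+ 2 * nm v).
    by rewrite !mulr_ge0 ?sqr_ge0 //; lra.
  have h4 : 0 <= e ^+ 2 * nm v by rewrite mulr_ge0 // sqr_ge0.
  have h5 : nm ((P 1%N).1 h v - p h v) <= (e + 2 * e ^+ 2) * nm v by exact: h1.
  lra.
have ls h : lin (s h).
  by apply: olim_lin r0 r1 (sP h) _ => n; have [lP _ _ _] := good n.+1; apply: lP.
have bs h : bop C (s h).
  by apply: olim_bop r0 r1 (sP h) _ _ => n; have [_ bP _ _] := good n.+1; apply: bP.
split=> //.
- move=> x xG; have hs := sP x; have ht := tP x xG.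
  split.
  + by apply: olim_adj r0 r1 hs ht _ => n; have [_ _ h _] := good n.+1; have [] := h x xG.
  + apply: (olim_cancel _ _ _ _ _ _ r0 r1 hs ht 1 0) => n.
    * have [lP _ h _] := good n.+1; have [hA _ _] := h x xG.
      exact: adj_lin hA (lP x).
    * by move=> v; rewrite mul1r (almost_rep_isometryV _ _ _ _ (good n.+1)).
    * move=> v; have [_ _ h _] := good n.+1; have [_ hK _] := h x xG.
      by rewrite hK subrr nm0 !mul0r.
  + apply: (olim_cancel _ _ _ _ _ _ r0 r1 ht hs 1 0) => n.
    * by have [lP _ _ _] := good n.+1; apply: lP.
    * by move=> v; rewrite mul1r (almost_rep_isometry _ _ _ _ (good n.+1)).
    * move=> v; have [_ _ h _] := good n.+1; have [_ _ hK] := h x xG.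
      by rewrite hK subrr nm0 !mul0r.
move=> x h xG v.
set K := 48 / 5 * C * e ^+ 2 / (1 - r) in sP.
rewrite mul0r.
pose K' := 8 * C * e ^+ 2.
(* The four constants belong to the limit error at [x * h], the defect of stage [n.+1], and the
   limit errors at [h] and at [x]; all decay like [r^n]. *)
apply: (le_of_geo _ _ (K * nm v + K' * nm v + K * nm v +
  K * nm (s h v)) r) => // n.
have [lP bP _ dP] := good n.+1.
have -> : s (x * h)%g v - s x (s h v) =
    (s (x * h)%g v - (P n.+1).1 (x * h)%g v) +
    ((P n.+1).1 (x * h)%g v - (P n.+1).1 x ((P n.+1).1 h v)) +
    (P n.+1).1 x ((P n.+1).1 h v - s h v) +
    ((P n.+1).1 x (s h v) - s x (s h v)).
  rewrite (linB ((P n.+1).1 x)) //; apply: rip_ext => z; rewrite !ripE; ring.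
rewrite add0r !mulrDl.
apply: le_trans (nmD _ _) _; apply: lerD; last first.
  by apply: le_trans (sP _ _ _) _; rewrite mulrAC.
apply: le_trans (nmD _ _) _; apply: lerD; last first.
  rewrite (almost_rep_isometry _ _ _ _ (good n.+1)) //.
  by apply: le_trans (sP _ _ _) _; rewrite mulrAC.
apply: le_trans (nmD _ _) _; apply: lerD.
  by rewrite nm_sub; apply: le_trans (sP _ _ _) _; rewrite mulrAC.
apply: le_trans (dP x h xG v) _; rewrite [X in _ <= X]mulrAC.
by apply: ler_wpM2r => //; apply: en_geo.
Qed.

End VectorMean.

(** * Operator norms versus pointwise bounds, and the conclusion *)

Lemma opnorm_bop (T : H -> H) (c : R) :
  hs_bounded_op ip T -> hs_opnorm ip T <= c -> bop c T.
Proof.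
move=> [lT [K TK]] Tc v.
have [->|v0] := eqVneq v 0; first by rewrite lin0 // nm0 mulr0.
have n0 : 0 < nm v.
  by rewrite lt_def nm_ge0 andbT; apply: contraNneq v0 => /nm_eq0 ->.
have i0 : 0 <= (nm v)^-1 by rewrite invr_ge0.
have : nm (T ((nm v)^-1%:C%C *: v)) <= c.
  (* A supremum dominates its members only if the set is bounded above, which is where boundedness
     of [T] enters. *)
  apply: le_trans Tc; apply: ub_le_sup.
    exists `|K| => _ [x x1 <-]; apply: le_trans (TK x) _.
    apply: (@le_trans _ _ (`|K| * nm x)).
      by apply: ler_wpM2r => //; apply: ler_norm.
    by rewrite -[X in _ <= X]mulr1; apply: ler_wpM2l.
  exists ((nm v)^-1%:C%C *: v) => //=.
  by rewrite nmZ ger0_norm // mulVf // gt_eqF.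
by rewrite linZ // nmZ ger0_norm // ler_pdivrMl // mulrC.
Qed.

Lemma bop_opnorm (T : H -> H) (c : R) : 0 <= c -> bop c T -> hs_opnorm ip T <= c.
Proof.
move=> c0 bT; apply: ge_sup; first by exists (nm (T 0)), 0 => //=; rewrite nm0.
move=> _ [x x1 <-]; apply: le_trans (bT x) _.
by rewrite -[X in _ <= X]mulr1; apply: ler_wpM2l.
Qed.

End HilbertSpace.

Theorem theorem2p2 (R : realType) (L : groupType) (Gam : {pred L})
  (C eps : R) (H : lmodType R[i]) (ip : H -> H -> R[i])
  (pi : L -> H -> H) :
  group_closed Gam ->
  amenable_subgroup R Gam ->
  1 <= C -> 0 < eps -> eps < (10 * C)^-1 ->
  hs_hilbert ip ->
  (forall h : L, hs_bounded_op ip (pi h)) ->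
  pi 1%g = id ->
  (forall x : L, x \in Gam -> hs_unitary ip (pi x)) ->
  (forall h : L, hs_opnorm ip (pi h) <= C) ->
  (forall x h : L, x \in Gam ->
     hs_opnorm ip (fun v => pi (x * h)%g v - pi x (pi h v)) <= eps) ->
  exists sigma : L -> H -> H,
    (forall h : L, hs_bounded_op ip (sigma h)) /\
    (forall h : L, hs_opnorm ip (fun v => sigma h v - pi h v) <= eps + 120 * C * eps ^+ 2) /\
    (forall x : L, x \in Gam -> hs_unitary ip (sigma x)) /\
    (forall h : L, hs_opnorm ip (sigma h) <= C) /\
    (forall x h : L, x \in Gam -> sigma (x * h)%g = sigma x \o sigma h).
Proof.
move=> gG amen C1 eps0 epsC hH bpi _ upi Cpi dpi.
have [I [ID IZ I_le I_cst [I_trans eq_I]]] := amenable_right_mean R L Gam gG amen.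
have lpi h : lin R H (pi h) by have [] := bpi h.
have bopC h : bop R H ip C (pi h) by apply: opnorm_bop.
have /choice[q qP] : forall x, exists V, x \in Gam ->
    [/\ adj R H ip (pi x) V, cancel (pi x) V & cancel V (pi x)].
  move=> x; have [/upi[_ [V [VA [VK KV]]]]|] := boolP (x \in Gam); last by exists id.
  by exists V => _; split=> // u v; rewrite /rip VA.
have e1 : 0 <= eps + 120 * C * eps ^+ 2.
  by have := sqr_ge0 eps => ?; rewrite addr_ge0 ?mulr_ge0 //; lra.
have pq : almost_rep R H ip L Gam C eps pi q.
  (* Reading the defect hypothesis pointwise first requires the defect operator itself to be linear
     and bounded, here by [C + C * C]. *)
  split=> // x h xG; apply: opnorm_bop => //; last exact: dpi.
  split.
    move=> a u v; rewrite !lpi scalerBr.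
    by apply: (rip_ext R H ip hH) => z; rewrite !(ripE R H ip hH); ring.
  exists (C + C * C) => v; apply: le_trans (nmD R H ip hH _ _) _.
  rewrite nmN // mulrDl; apply: lerD; first exact: bopC.
  apply: le_trans (bopC _ _) _; rewrite -mulrA; apply: ler_wpM2l; first by lra.
  exact: bopC.
have [s [t [[ls bs st ms] sd]]] := almost_rep_limit R H ip hH L Gam I gG ID IZ I_le I_cst
  I_trans eq_I C eps pi q C1 (ltW eps0) (ltW epsC) pq.
have bds h : hs_bounded_op ip (s h).
  by split; [apply: ls|exists C => v; apply: bs].
exists s; split=> //.
split=> [h|]; first exact: bop_opnorm.
split=> [x xG|].
  have [sA sK tK] := st x xG; split=> //.
  by exists (t x); split=> // u v; apply: (adj_ip R H ip hH).
split=> [h|x h xG]; first by apply: bop_opnorm => //; lra.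
apply/funext => v /=; apply/eqP; rewrite -subr_eq0; apply/eqP/(nm_eq0 R H ip hH)/eqP.
by rewrite eq_le nm_ge0 andbT; have := ms x h xG v; rewrite mul0r.
Qed.
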